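(* The following chain of proper inclusions of graph classes holds: $$0\text{-}HNG \subset 0\text{-}NG \subset 1\text{-}HNG \subset 1\text{-}NG \subset 2\text{-}HNG \subset \cdots,$$ that is, for every integer $a\ge 0$, $a\text{-}HNG \subsetneq a\text{-}NG \subsetneq (a+1)\text{-}HNG$.
   Context: All graphs are finite, simple, and have at least one vertex; induced subgraphs are taken on nonempty vertex sets. $\chi(G)$ is the chromatic number and $\theta(G)=\chi(\overline{G})$ the clique cover number. For an integer $a\ge 0$, $a$-$NG$ is the class of graphs $G$ with $\chi(G)+\theta(G)\ge |V(G)|+1-a$, and $a$-$HNG$ is the class of graphs $G$ such that every induced subgraph $H$ of $G$ (including $G$ itself) satisfies $\chi(H)+\theta(H)\ge |V(H)|+1-a$. *)

(* Defs.v *)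
From HB Require Import structures.
From mathcomp Require Import all_boot.

Set Implicit Arguments.
Unset Strict Implicit.
Unset Printing Implicit Defensive.

Record graph := Graph {
  vertex :> finType;
  edge : rel vertex;
  edge_sym : symmetric edge;
  edge_irrefl : irreflexive edge;
  vertex_gt0 : 0 < #|vertex|
}.

Section Complement.
Variable G : graph.

Definition compl_edge : rel G := fun x y => (x != y) && ~~ edge x y.

Lemma compl_edge_sym : symmetric compl_edge.
Proof. by move=> x y; rewrite /compl_edge eq_sym edge_sym. Qed.

Lemma compl_edge_irrefl : irreflexive compl_edge.
Proof. by move=> x; rewrite /compl_edge eqxx. Qed.

Definition complement : graph :=
  Graph compl_edge_sym compl_edge_irrefl (vertex_gt0 G).

End Complement.

Section Induced.
Variables (G : graph) (S : {set G}) (S_neq0 : S != set0).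

Definition induced_edge : rel {x : G | x \in S} :=
  fun x y => edge (val x) (val y).

Lemma induced_edge_sym : symmetric induced_edge.
Proof. by move=> x y; rewrite /induced_edge edge_sym. Qed.

Lemma induced_edge_irrefl : irreflexive induced_edge.
Proof. by move=> x; rewrite /induced_edge edge_irrefl. Qed.

Lemma induced_vertex_gt0 : 0 < #|{: {x : G | x \in S}}|.
Proof. by rewrite card_sig; move: S_neq0; rewrite -card_gt0. Qed.

Definition induced : graph :=
  Graph induced_edge_sym induced_edge_irrefl induced_vertex_gt0.

End Induced.

Definition colorable (G : graph) (k : nat) : bool :=
  [exists f : {ffun G -> 'I_k},
    [forall x, forall y, edge x y ==> (f x != f y)]].

Lemma ex_colorable (G : graph) : exists k, colorable G k.
Proof.
exists #|G|; apply/existsP; exists [ffun x => enum_rank x].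
apply/forallP=> x; apply/forallP=> y; apply/implyP=> exy.
rewrite !ffunE (inj_eq enum_rank_inj); apply/negP=> /eqP eq_xy.
by rewrite eq_xy edge_irrefl in exy.
Qed.

Definition chi (G : graph) : nat := ex_minn (ex_colorable G).

Definition theta (G : graph) : nat := chi (complement G).

(* The subtraction on nat is truncated at 0, which is harmless here because
   the right-hand side is a natural number. *)
Definition NG (a : nat) (G : graph) : Prop :=
  #|G| + 1 - a <= chi G + theta G.

Definition HNG (a : nat) (G : graph) : Prop :=
  forall (S : {set G}) (S_neq0 : S != set0), NG a (induced S_neq0).

Definition proper_subclass (A B : graph -> Prop) : Prop :=
  (forall G, A G -> B G) /\ (exists G, B G /\ ~ A G).

(* Main.v *)
Require Import Defs.
From mathcomp Require Import all_boot.
From mathcomp Require Import zify.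

(** Write d(G) = |G| + 1 - chi(G) - theta(G), so that a-NG means d(G) <= a.
    If H is an induced subgraph of G and R is the set of remaining vertices,
    then chi(G) <= chi(H) + chi(R) and theta(G) <= theta(H) + theta(R), while
    chi(R) + theta(R) <= |R| + 1 by the Nordhaus-Gaddum inequality; hence
    d(H) <= d(G) + 1.

    For strictness, the odd cycle C on 2a + 5 vertices has d(C) = a, whereas
    the path P obtained by deleting a vertex of C has d(P) = a + 1.  So C
    separates a-HNG from a-NG; and every induced subgraph of P is one of C,
    hence P is in (a+1)-HNG but not in a-NG. *)

Set Implicit Arguments.
Unset Strict Implicit.
Unset Printing Implicit Defensive.

(** Colourings live on all of [T] and are constrained only on [S]. This allows [S] to be empty,
    which [graph] forbids, and lets a colouring be extended vertex by vertex without changing its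
    type. *)
Definition proper_on (T : finType) (e : rel T) (S : {set T}) (k : nat)
    (f : T -> nat) : Prop :=
  {in S, forall x, f x < k} /\ {in S &, forall x y, e x y -> f x != f y}.

Lemma chi_leP (G : graph) (k : nat) :
  chi G <= k <-> exists f, proper_on (@edge G) [set: G] k f.
Proof.
rewrite /chi; case: ex_minnP => m /existsP[f /forallP fP] m_min; split.
  move=> le_mk; exists (fun x => nat_of_ord (f x)); split=> [x _|x y _ _ exy].
    exact: leq_trans (ltn_ord _) le_mk.
  by have /forallP/(_ y)/implyP/(_ exy) := fP x.
case=> g [ltg gP]; apply: m_min; apply/existsP.
exists [ffun x => Ordinal (ltg x (in_setT x))].
apply/forallP=> x; apply/forallP=> y; apply/implyP=> exy.
by rewrite !ffunE -val_eqE /= gP ?in_setT.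
Qed.

Section NordhausGaddum.
Variables (T : finType).
Implicit Types (e : rel T) (S : {set T}).

Lemma proper_on_setU1 e S v k k' c f :
    symmetric e -> irreflexive e -> v \notin S -> k <= k' -> c < k' ->
    {in S, forall x, e v x -> f x != c} -> proper_on e S k f ->
  proper_on e (v |: S) k' (fun x => if x == v then c else f x).
Proof.
move=> e_sym e_irr vS le_k lt_c cP [f_lt fP].
have neq_v x : x \in S -> (x == v) = false.
  by move=> xS; apply: contraNF vS => /eqP <-.
split=> [x|x y].
  by case/setU1P=> [->|xS]; rewrite ?eqxx ?neq_v // (leq_trans (f_lt _ xS)).
case/setU1P=> [->|xS] /setU1P[->|yS]; rewrite ?eqxx ?neq_v // ?e_irr //.
- by move=> /(cP _ yS); rewrite eq_sym.
- by rewrite e_sym; apply: cP.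
- exact: fP.
Qed.

Lemma proper_on_fresh e S v k f :
    symmetric e -> irreflexive e -> v \notin S -> proper_on e S k f ->
  exists g, proper_on e (v |: S) k.+1 g.
Proof.
move=> e_sym e_irr vS fP; eexists; apply: (@proper_on_setU1 _ _ _ k _ k f) => //.
by move=> x xS _; rewrite ltn_eqF // (fP.1 _ xS).
Qed.

(** The neighbours of [v] in [S] use fewer than [k] colours, so one of the [k] colours is free for
    [v]. *)
Lemma proper_on_greedy e S v k f :
    symmetric e -> irreflexive e -> v \notin S -> proper_on e S k f ->
    #|[set x in S | e v x]| < k ->
  exists g, proper_on e (v |: S) k g.
Proof.
move=> e_sym e_irr vS fP deg_lt.
pose used := [seq f x | x <- enum [set x in S | e v x]].
have /allPn[c] : ~~ all [in used] (iota 0 k).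
  apply: contraL deg_lt => /allP sub; rewrite -leqNgt cardE -(size_map f).
  by rewrite -(size_iota 0 k); apply: uniq_leq_size sub; apply: iota_uniq.
rewrite mem_iota => /andP[_ lt_c] /= c_free.
eexists; apply: (@proper_on_setU1 _ _ _ k _ c f) => // x xS evx.
by apply: contraNneq c_free => <-; apply: map_f; rewrite mem_enum inE xS.
Qed.

End NordhausGaddum.

(** Induction, removing a vertex [v]. If the bound for [S :\ v] has slack, a fresh colour is
    affordable on both sides. Otherwise the degrees of [v] in the graph and in its complement sum to
    [#|S :\ v|], which is less than [k + l]; so on one side the degree is below the number of
    colours, and the greedy step saves a colour there. *)
Lemma nordhaus_gaddum (G : graph) (S : {set G}) :
  exists k l f g, [/\ proper_on (@edge G) S k f,
    proper_on (@compl_edge G) S l g & k + l <= #|S| + 1].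
Proof.
have [n] := ubnP #|S|; elim: n S => // n IHn S lt_n.
have [->|[v vS]] := set_0Vmem S.
  by exists 0, 0, (fun=> 0), (fun=> 0); split=> //; (split=> [x|x y]; rewrite inE).
have v_new : v \notin S :\ v by rewrite setD11.
have cardS : #|S| = #|S :\ v|.+1 by rewrite (cardsD1 v) vS.
have [|k [l [f [g [fP gP le_kl]]]]] := IHn (S :\ v); first lia.
have sG := @edge_sym G; have iG := @edge_irrefl G.
have sC := @compl_edge_sym G; have iC := @compl_edge_irrefl G.
have [f1 f1P] := proper_on_fresh sG iG v_new fP.
have [g1 g1P] := proper_on_fresh sC iC v_new gP.
rewrite -(setD1K vS) cardsU1 v_new.
have [le_sum|gt_sum] := leqP (k + l) #|S :\ v|.
  by exists k.+1, l.+1, f1, g1; split=> //; lia.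
have deg : #|[set x in S :\ v | edge v x]|
         + #|[set x in S :\ v | compl_edge v x]| = #|S :\ v|.
  rewrite -(cardsID [set x | edge v x] (S :\ v)); congr (_ + _); apply: eq_card => x.
    by rewrite !inE.
  by rewrite !inE /compl_edge [v == x]eq_sym; case: (x == v); case: (x \in S); case: edge.
have [lt_k|ge_k] := ltnP #|[set x in S :\ v | edge v x]| k.
  have [f2 f2P] := proper_on_greedy sG iG v_new fP lt_k.
  by exists k, l.+1, f2, g1; split=> //; lia.
have lt_l : #|[set x in S :\ v | compl_edge v x]| < l by lia.
have [g2 g2P] := proper_on_greedy sC iC v_new gP lt_l.
by exists k.+1, l, f1, g2; split=> //; lia.
Qed.

(** Induced subgraphs up to isomorphism: in this form they compose, and the same map serves for the
    complements. *)
Definition embedding (H G : graph) (h : H -> G) : Prop :=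
  injective h /\ {mono h : x y / edge x y}.

Lemma embedding_complement (H G : graph) (h : H -> G) :
  embedding h -> @embedding (complement H) (complement G) h.
Proof.
by case=> h_inj h_mono; split=> // x y; rewrite /= /compl_edge h_mono inj_eq.
Qed.

Lemma embedding_val (G : graph) (S : {set G}) (S_neq0 : S != set0) :
  @embedding (induced S_neq0) G val.
Proof. by split=> //; apply: val_inj. Qed.

Lemma embedding_comp (K H G : graph) (h : H -> G) (j : K -> H) :
  embedding h -> embedding j -> embedding (h \o j).
Proof.
move=> [h_inj h_mono] [j_inj j_mono]; split; first exact: inj_comp.
by move=> x y; rewrite /= h_mono j_mono.
Qed.

Lemma chi_embedding (H G : graph) (h : H -> G) :
  embedding h -> chi H <= chi G.
Proof.
case=> _ h_mono; have [/(_ (leqnn _))[f [f_lt fP]] _] := chi_leP G (chi G).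
apply/chi_leP; exists (f \o h); split=> [x _|x y _ _ exy] /=.
  by rewrite f_lt ?in_setT.
by rewrite fP ?in_setT ?h_mono.
Qed.

Lemma chi_leD (H G : graph) (h : H -> G) (k : nat) (g : G -> nat) :
    embedding h -> proper_on (@edge G) (~: [set y in codom h]) k g ->
  chi G <= chi H + k.
Proof.
case=> h_inj h_mono [g_lt gP].
have [/(_ (leqnn _))[f [f_lt fP]] _] := chi_leP H (chi H).
(* The copy of [H] keeps its optimal colouring; the remaining vertices get colours shifted past
   [chi H]. *)
pose c x := if [pick z | h z == x] is Some z then f z else chi H + g x.
have cP x : (exists2 z, x = h z & c x = f z)
         \/ (x \in ~: [set y in codom h] /\ c x = chi H + g x).
  rewrite /c; case: pickP => [z /eqP <-|no_z]; first by left; exists z.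
  right; split=> //; rewrite !inE; apply/codomP=> -[z xz].
  by have := no_z z; rewrite xz eqxx.
have f_ltT z : f z < chi H by rewrite f_lt ?in_setT.
apply/chi_leP; exists c; split=> [x _|x y _ _].
  case: (cP x) => [[z _ ->]|[xR ->]]; first by have := f_ltT z; lia.
  by rewrite ltn_add2l g_lt.
case: (cP x) => [[z -> ->]|[xR ->]]; case: (cP y) => [[t -> ->]|[yR ->]].
- by rewrite h_mono; apply: fP; rewrite in_setT.
- by have := f_ltT z; lia.
- by have := f_ltT t; lia.
- by rewrite eqn_add2l; apply: gP.
Qed.

Lemma NG_embedding (H G : graph) (h : H -> G) (a : nat) :
  embedding h -> NG a G -> NG a.+1 H.
Proof.
move=> hE; have [k [l [f [g [fP gP]]]]] := nordhaus_gaddum (~: [set y in codom h]).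
have le_chi := chi_leD hE fP.
have le_theta := chi_leD (embedding_complement hE) gP.
have cardG := cardsC [set y in codom h].
rewrite [X in X + _]cardsE card_codom in cardG; last by case: hE.
rewrite /NG /theta; lia.
Qed.

(** The subgraph induced on [[set: G]] has a sigma type of vertices, so it is not literally [G]; its
    parameters are compared with those of [G] through the embedding [val]. *)
Lemma HNG_NG (a : nat) (G : graph) : HNG a G -> NG a G.
Proof.
have T_neq0 : [set: G] != set0 by rewrite -card_gt0 cardsT vertex_gt0.
move=> /(_ _ T_neq0); have hE := embedding_val T_neq0.
have := chi_embedding hE; have := chi_embedding (embedding_complement hE).
have : #|induced T_neq0| = #|G| by rewrite card_sig -cardsT; apply: eq_card => x; rewrite inE.
rewrite /NG /theta; lia.
Qed.

Section OddCycle.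
Variable a : nat.
(** The last vertex of the cycle, which thus has an odd number of vertices, at least five. *)
Let n := a.*2 + 4.

Definition cycle_edge : rel 'I_n.+1 := fun x y =>
  [|| y == x.+1 :> nat, x == y.+1 :> nat, (x == 0 :> nat) && (y == n :> nat)
    | (y == 0 :> nat) && (x == n :> nat)].

Lemma cycle_edge_sym : symmetric cycle_edge.
Proof. by move=> x y; rewrite /cycle_edge; lia. Qed.

Lemma cycle_edge_irrefl : irreflexive cycle_edge.
Proof. by move=> x; rewrite /cycle_edge /n; lia. Qed.

Lemma ord_gt0 : 0 < #|'I_n.+1|.
Proof. by rewrite card_ord. Qed.

Definition odd_cycle : graph := Graph cycle_edge_sym cycle_edge_irrefl ord_gt0.

Lemma chi_odd_cycle : 2 < chi odd_cycle.
Proof.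
rewrite ltnNge; apply/negP => /chi_leP[f [f_lt fP]].
have lt2 m : f (inord m) < 2 by rewrite f_lt ?in_setT.
have step m : m < n -> f (inord m) != f (inord m.+1).
  move=> lt_m; rewrite fP ?in_setT //= /cycle_edge !inordK ?eqxx //; lia.
(* Two colours must alternate along the cycle; as [n] is even, the closing edge from [n] to 0 is
   monochromatic. *)
have alt m : m <= n -> (f (inord m) == f (inord 0)) = ~~ odd m.
  elim: m => [|m IHm] le_m; first by rewrite eqxx.
  have := IHm (ltnW le_m); have := step m le_m.
  have := lt2 m; have := lt2 m.+1; have := lt2 0 => /=; lia.
have /negP[] : f (inord n) != f (inord 0).
  by rewrite fP ?in_setT //= /cycle_edge !inordK // !eqxx !orbT.
by rewrite alt // /n; lia.
Qed.

Lemma theta_odd_cycle : a + 2 < theta odd_cycle.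
Proof.
rewrite ltnNge; apply/negP => /chi_leP[f [f_lt fP]].
have f_ltT x : f x < a + 2 by rewrite f_lt ?in_setT.
(* A colour class of the complement is a clique of the cycle, which has no triangle. Hence [a + 2]
   classes cover at most [2a + 4] of the [2a + 5] vertices. *)
have class_le2 (c : 'I_(a + 2)) : \sum_(x : 'I_n.+1 | Ordinal (f_ltT x) == c) 1 <= 2.
  rewrite sum1_card leqNgt; apply/negP => /card_gt2P[x [y [z [[]]]]].
  rewrite !unfold_in => /eqP xc /eqP yc /eqP zc [xy yz zx].
  have adj u v : f u = c -> f v = c -> u != v -> cycle_edge u v.
    move=> uc vc uv; apply: contraT => nuv.
    have := fP u v (in_setT u) (in_setT v).
    rewrite /= /compl_edge uv nuv => /(_ isT) /eqP[].
    by rewrite uc vc.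
  have := adj x y xc yc xy; have := adj y z yc zc yz; have := adj z x zc xc zx.
  move: xy yz zx; rewrite -!val_eqE /cycle_edge /n /=; lia.
have : \sum_(x : 'I_n.+1) 1 <= \sum_(c < a + 2) 2.
  rewrite (partition_big (fun x => Ordinal (f_ltT x)) xpredT) //=.
  exact: leq_sum.
rewrite !sum_nat_const !card_ord /n; lia.
Qed.

Lemma NG_odd_cycle : NG a odd_cycle.
Proof.
have := chi_odd_cycle; have := theta_odd_cycle.
by rewrite /NG card_ord /n; lia.
Qed.

Lemma path_neq0 : [set~ ord_max : odd_cycle] != set0.
Proof. by rewrite -card_gt0 cardsC1 card_ord /n; lia. Qed.

Definition even_path : graph := induced path_neq0.

Definition pos (x : even_path) : nat := (val x : 'I_n.+1).

Lemma pos_lt x : pos x < n.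
Proof.
by rewrite ltn_neqAle -ltnS ltn_ord andbT; have := valP x; rewrite !inE -val_eqE.
Qed.

Lemma pos_inj : injective pos.
Proof. by move=> x y /val_inj/val_inj. Qed.

Lemma edge_even_path x y :
  edge x y = (pos y == (pos x).+1) || (pos x == (pos y).+1).
Proof.
have -> : edge x y = cycle_edge (val x) (val y) by [].
by rewrite /cycle_edge -!/(pos _) !(ltn_eqF (pos_lt _)) !andbF !orbF.
Qed.

Lemma chi_even_path : chi even_path <= 2.
Proof.
apply/chi_leP; exists (odd \o pos); split=> [x _|x y _ _].
  by rewrite /=; case: odd.
by rewrite edge_even_path /=; lia.
Qed.

Lemma theta_even_path : theta even_path <= a + 2.
Proof.
(* The path is covered by the [a + 2] disjoint edges joining positions [2i] and [2i + 1]. *)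
apply/chi_leP; exists (half \o pos); split=> [x _|x y _ _].
  by have := pos_lt x; rewrite /n /=; lia.
by case/andP; rewrite edge_even_path -(inj_eq pos_inj) /=; lia.
Qed.

(** With [2a + 4] vertices, [NG a] would require [a + 5], but the two parameters sum to at most
    [2 + (a + 2)]. *)
Lemma not_NG_even_path : ~ NG a even_path.
Proof.
have := chi_even_path; have := theta_even_path.
rewrite /NG card_sig [#|_|](_ : _ = #|[set~ ord_max : odd_cycle]|).
  by rewrite cardsC1 card_ord /n; lia.
by apply: eq_card => x; rewrite inE.
Qed.

End OddCycle.

Theorem proposition1p1 (a : nat) :
  proper_subclass (HNG a) (NG a) /\ proper_subclass (NG a) (HNG a.+1).
Proof.
split; split.
- exact: HNG_NG.
- exists (odd_cycle a); split; first exact: NG_odd_cycle.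
  by move=> /(_ _ (path_neq0 a)); apply: not_NG_even_path.
- by move=> G aG S S_neq0; apply: NG_embedding aG; apply: embedding_val.
- exists (even_path a); split; last exact: not_NG_even_path.
  move=> S S_neq0; apply: NG_embedding (NG_odd_cycle a).
  exact: embedding_comp (embedding_val _) (embedding_val S_neq0).
Qed.
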